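(* For any graph $G$, $$2 + \frac{2}{g_o(G)-2} \le \chi_q(G) \le 2\left\lceil \frac{\chi(G)}{2} \right\rceil.$$ Equivalently, $$1 + \frac{1}{g_o(G)-1} \le x(G) \le 2 - \frac{1}{\lceil \chi(G)/2\rceil}.$$ In particular, $x(G) \in [1,2)$ and $\chi_q(G) \ge 2$.
   Context: All graphs are finite, undirected, loopless, and have at least one edge. For $W \subseteq V(G)$, $\delta(W)$ denotes the set of edges of $G$ with exactly one end in $W$; a cut of $G$ is any edge set of the form $\delta(W)$. For positive integers $n,k$, an $n/k$-cover of $G$ is an $n$-tuple $(X_1,\dots,X_n)$ of cuts in $G$ (repetitions allowed) such that every edge of $G$ lies in at least $k$ of them. The fractional cut-covering number is $x(G) = \inf\{ n/k \mid \text{there exists an } n/k\text{-cover of } G\}$, and the cubical chromatic number is $\chi_q(G) = \frac{2}{2-x(G)}$. $\chi(G)$ is the chromatic number. $g_o(G)$ is the odd girth, the length of a shortest odd cycle in $G$; if $G$ is bipartite, $g_o(G)=\infty$ and the fractions $\frac{2}{g_o(G)-2}$ and $\frac{1}{g_o(G)-1}$ are read as $0$. *)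

(* Defs.v *)
From mathcomp Require Import all_boot all_order all_algebra.
From mathcomp Require Import boolp classical_sets reals.

Set Implicit Arguments.
Unset Strict Implicit.
Unset Printing Implicit Defensive.

Import Order.TTheory GRing.Theory Num.Theory.

Local Open Scope ring_scope.

(* Finite undirected loopless graphs; parallel edges are allowed, the simple
   graphs being those for which [ends] is injective. *)
Record graph := Graph {
  vertex : finType;
  edge : finType;
  ends : edge -> {set vertex};
  card_ends : forall e : edge, #|ends e| = 2%N
}.

Arguments ends {g} e.

Definition adj (G : graph) : rel (vertex G) :=
  fun u v => [exists e : edge G, ends e == [set u; v]].

Lemma adj_irr (G : graph) : irreflexive (@adj G).
Proof.
move=> u; apply/existsP => -[e /eqP he].
by have := card_ends e; rewrite he finset.setUid cards1.
Qed.

Definition colorable (G : graph) (k : nat) : bool :=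
  [exists f : {ffun vertex G -> 'I_k},
    [forall u, forall v, adj u v ==> (f u != f v)]].

Lemma colorable_card (G : graph) : exists k, colorable G k.
Proof.
exists #|vertex G|; apply/existsP; exists [ffun u => enum_rank u].
apply/forallP => u; apply/forallP => v; apply/implyP => huv.
rewrite !ffunE (inj_eq enum_rank_inj); apply: contraTneq huv => ->.
by rewrite adj_irr.
Qed.

Definition chromatic_number (G : graph) : nat := ex_minn (colorable_card G).

Definition has_cycle (G : graph) (n : nat) : bool :=
  (0 < n)%N &&
  [exists vs : n.-tuple (vertex G), exists es : n.-tuple (edge G),
    [&& uniq vs, uniq es &
      [forall i : 'I_n, ends (tnth es i) == [set tnth vs i; tnth vs (ordS i)]]]].

(* [None] stands for infinity *)
Definition odd_girth (G : graph) : option nat :=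
  if pselect (exists n, odd n && has_cycle G n) is left h
  then Some (ex_minn h) else None.

(* a / (g_o(G) - b), with value 0 when g_o(G) is infinite *)
Definition odd_girth_frac (R : realType) (G : graph) (a b : R) : R :=
  if odd_girth G is Some g then a / (g%:R - b) else 0.

Definition delta (G : graph) (W : {set vertex G}) : {set edge G} :=
  [set e | #|ends e :&: W| == 1%N].

Definition is_cut (G : graph) (X : {set edge G}) : Prop :=
  exists W : {set vertex G}, X = delta W.

Definition is_cover (G : graph) (n k : nat) (X : n.-tuple {set edge G}) : Prop :=
  (forall i : 'I_n, is_cut (tnth X i)) /\
  (forall e : edge G, (k <= #|[set i : 'I_n | e \in tnth X i]|)%N).

Local Open Scope classical_set_scope.

Definition cut_cover_number (R : realType) (G : graph) : R :=
  inf [set r : R | exists n k : nat,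
    [/\ (0 < n)%N, (0 < k)%N,
        exists X : n.-tuple {set edge G}, is_cover k X
      & r = n%:R / k%:R]].

Definition cubical_chromatic_number (R : realType) (G : graph) : R :=
  2 / (2 - cut_cover_number R G).

(* Main.v *)
Require Import Defs.
From mathcomp Require Import all_boot all_order all_algebra.
From mathcomp Require Import boolp classical_sets reals.
From mathcomp Require Import zify ring lra.

(** Both bounds on [chi_q] are the images of the bounds on [x] under the
    increasing map [x |-> 2 / (2 - x)], so everything reduces to [x].

    Lower bound.  A cut meets a closed walk in an even number of edges, since
    the walk changes side each time it uses an edge of the cut
    ([cut_cycle_even]).  Hence a cut contains at most [g - 1] edges of an odd
    cycle of length [g].  Counting the incidences between the edges of the
    cycle and the [n] cuts of an [n/k]-cover in two ways gives
    [g * k <= n * (g - 1)] ([cover_odd_cycle]), that is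
    [n / k >= 1 + 1 / (g - 1)].  Without odd cycles, [k <= n] already gives
    the bound [1].

    Upper bound.  Let [h] be half the chromatic number, rounded up, and
    properly colour [G] with [2h] colours.  Each set [S] of [h] colours yields
    a cut, between the vertices with colour in [S] and the others.  An edge
    lies in this cut exactly when [S] separates the two colours of its ends,
    which happens for [2 * 'C(2h - 2, h - 1)] of the ['C(2h, h)] sets.  These
    cuts thus form a cover of ratio
    ['C(2h, h) / (2 * 'C(2h - 2, h - 1)) = (2h - 1) / h = 2 - 1 / h]
    ([colorable_cover], [balanced_cover]). *)

Import Order.TTheory GRing.Theory Num.Theory.

(** * Cuts and odd cycles *)

Lemma mem_delta {G : graph} (W : {set vertex G}) {e : edge G} {u v : vertex G} :
  ends e = [set u; v]%SET -> (e \in delta W) = (u \in W) (+) (v \in W).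
Proof.
move=> he; have neq_uv : u != v by have := card_ends e; rewrite he cards2; case: eqP.
rewrite inE he -sum1_card (eq_bigl (fun x => (x \in [set u; v]%SET) && (x \in W)));
  last by move=> x; rewrite finset.in_setI.
rewrite big_mkcondr big_setU1 ?inE //= finset.big_set1.
by case: (u \in W); case: (v \in W).
Qed.

Lemma ends_pair {G : graph} (e : edge G) : exists u v : vertex G, ends e = [set u; v]%SET.
Proof. by have /eqP/cards2P [u [v [_ ->]]] := card_ends e; exists u, v. Qed.

(** Membership of an edge in a cut is the exclusive or of the sides of its two
    ends, and around a cycle every vertex is an end twice, so the exclusive or
    over all the edges vanishes. *)
Lemma cut_cycle_even {G : graph} (W : {set vertex G}) {g : nat}
    {vs : g.-tuple (vertex G)} {es : g.-tuple (edge G)} :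
    (forall j, ends (tnth es j) = [set tnth vs j; tnth vs (ordS j)]%SET) ->
  ~~ odd (\sum_(j < g) (tnth es j \in delta W)).
Proof.
move=> hes; rewrite (big_morph odd oddD (erefl _)).
under eq_bigr => j _ do rewrite oddb (mem_delta _ (hes j)).
rewrite big_split /= [X in X (+) _](reindex_inj (@ordS_inj g)) /=.
by rewrite addbb.
Qed.

(** A cycle of length one would be a loop. *)
Lemma odd_cycle_gt2 {G : graph} {g : nat} : odd g -> has_cycle G g -> (2 < g)%N.
Proof.
case: g => [//|[_|[//|//]]] /andP [_ /existsP [vs /existsP [es]]].
move=> /and3P [_ _ /forallP/(_ ord0)/eqP he].
have := card_ends (tnth es ord0).
by rewrite he (_ : ordS ord0 = ord0) ?finset.setUid ?cards1 //; apply: val_inj.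
Qed.

Lemma cover_sumE {n : nat} {T : finType} (X : n.-tuple {set T}) (e : T) :
  #|[set i : 'I_n | e \in tnth X i]%SET| = \sum_(i < n) (e \in tnth X i).
Proof. by rewrite -sum1_card big_mkcond; apply: eq_bigr => i _; rewrite inE; case: ifP. Qed.

(** Double counting of the pairs formed by an edge of the cycle and a cut of the
    cover that contains it: each edge is in at least [k] such pairs, and each
    cut in at most [g - 1], since it meets the cycle evenly and [g] is odd. *)
Lemma cover_odd_cycle {G : graph} {n k : nat} {X : n.-tuple {set edge G}} (g : nat) :
  is_cover k X -> odd g -> has_cycle G g -> (g * k <= n * g.-1)%N.
Proof.
move=> [cutX covX] odd_g /andP [_ /existsP [vs /existsP [es /and3P [_ _ /forallP hes]]]].
rewrite -[X in (X * k)%N](card_ord g) -[X in (X * g.-1)%N](card_ord n) -!sum_nat_const.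
apply: (@leq_trans (\sum_(j < g) \sum_(i < n) (tnth es j \in tnth X i))).
  by apply: leq_sum => j _; rewrite -cover_sumE.
rewrite exchange_big; apply: leq_sum => i _ /=.
have [W ->] := cutX i.
have even_s := cut_cycle_even W (fun j => eqP (hes j)).
have le_sg : \sum_(j < g) (tnth es j \in delta W) <= g.
  by rewrite -[leqRHS]card_ord -sum1_card; apply: leq_sum => j _; apply: leq_b1.
move: (\sum_(j < g) _) even_s le_sg => s; lia.
Qed.

Lemma cover_leq {G : graph} {n k : nat} {X : n.-tuple {set edge G}} :
  (0 < #|edge G|)%N -> is_cover k X -> (k <= n)%N.
Proof.
move=> /card_gt0P [e _] [_ /(_ e) /leq_trans]; apply.
by rewrite -[leqRHS]card_ord; apply: max_card.
Qed.

(** * Covers from colourings *)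

(** Adding [a] to an [m]-subset of the complement of [{a, b}] injects those
    subsets into the sets of size [m + 1] that contain [a] but not [b]. *)
Lemma card_draws_with_without {T : finType} {a b : T} (m : nat) : a != b ->
  'C(#|T|.-2, m) <= #|[set S : {set T} | [&& #|S| == m.+1, a \in S & b \notin S]]%SET|.
Proof.
move=> neq_ab.
have <- : #|~: [set a; b]|%SET = #|T|.-2.
  by have := cardsC [set a; b]%SET; rewrite cards2 neq_ab; lia.
have notin (A : {set T}) : A \subset (~: [set a; b])%SET -> (a \notin A) && (b \notin A).
  by move=> /fintype.subsetP sA; apply/andP; split; apply/negP=> /sA; rewrite !inE eqxx ?orbT.
rewrite -cards_draws -(card_in_imset (f := fun A => (a |: A)%SET)).
  apply/subset_leq_card/fintype.subsetP => S /imsetP [A].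
  rewrite inE => /andP [/notin /andP [aA bA] /eqP cA] ->.
  by rewrite !inE cardsU1 aA cA add1n !eqxx negb_or [b == a]eq_sym neq_ab.
move=> A B; rewrite !inE => /andP [/notin /andP [aA _] _] /andP [/notin /andP [aB _] _] eqAB.
by rewrite -(setU1K aA) eqAB setU1K.
Qed.

Lemma card_draws_separating {T : finType} {a b : T} (m : nat) : a != b ->
  2 * 'C(#|T|.-2, m) <=
  #|[set S : {set T} | (#|S| == m.+1) && ((a \in S) (+) (b \in S))]%SET|.
Proof.
move=> neq_ab; rewrite mul2n -addnn.
have neq_ba : b != a by rewrite eq_sym.
apply: leq_trans
  (leq_add (card_draws_with_without m neq_ab) (card_draws_with_without m neq_ba)) _.
rewrite -cardsUI; set I := (_ :&: _)%SET.
have -> : I = finset.set0.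
  by apply/setP => S; rewrite !inE; case: (a \in S); rewrite ?andbF.
rewrite cards0 addn0; apply/subset_leq_card/fintype.subsetP => S; rewrite !inE.
by case: (a \in S); case: (b \in S); rewrite /= ?andbF ?orbF.
Qed.

Lemma colorable_edge {G : graph} {k : nat} : colorable G k ->
  exists f : vertex G -> 'I_k,
    forall (e : edge G) u v, ends e = [set u; v]%SET -> f u != f v.
Proof.
move=> /existsP [f /forallP col_f]; exists f => e u v he.
by have /forallP/(_ v)/implyP := col_f u; apply; apply/existsP; exists e; apply/eqP.
Qed.

(** The cuts are indexed by the balanced sets [S] of colours, those with half of
    the [2 (m + 1)] colours; the cut of [S] contains an edge exactly when [S]
    separates the colours of its ends. *)
Lemma colorable_cover {G : graph} {m : nat} : colorable G m.+1.*2 ->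
  exists X : 'C(m.+1.*2, m.+1).-tuple {set edge G}, is_cover (2 * 'C(m.*2, m)) X.
Proof.
move=> /colorable_edge [f col_f].
set C := 'I_m.+1.*2; pose D := [set S : {set C} | #|S| == m.+1]%SET.
have -> : 'C(m.+1.*2, m.+1) = #|D| by rewrite card_draws card_ord.
pose cut (S : {set C}) : {set edge G} := delta [set v | f v \in S]%SET.
exists (map_tuple cut (enum_tuple D)); split=> [i|e].
  by rewrite tnth_map; eexists.
have [u [v he]] := ends_pair e.
have neq_f := col_f _ _ _ he.
have -> : m.*2 = #|{: C}|.-2 by rewrite card_ord.
apply: leq_trans (card_draws_separating m neq_f) _.
rewrite cover_sumE; under eq_bigr => i _ do rewrite tnth_map.
rewrite -(big_tuple _ _ (enum_tuple D) xpredT (fun S => (e \in cut S) : nat)) /= big_enum.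
rewrite -sum1_card big_mkcond [leqRHS]big_mkcond /=; apply: leq_sum => S _.
rewrite /cut (mem_delta _ he) !inE.
by case: (#|S| == _) => //=; case: (_ (+) _).
Qed.

Lemma colorableW {G : graph} {k l : nat} : (k <= l)%N -> colorable G k -> colorable G l.
Proof.
move=> le_kl /existsP [f /forallP col_f]; apply/existsP.
exists [ffun v => widen_ord le_kl (f v)]; apply/forallP => u; apply/forallP => v.
have /forallP/(_ v) := col_f u; rewrite !ffunE.
by congr (_ ==> ~~ _); rewrite -!val_eqE.
Qed.

Lemma chromatic_number_ge2 (G : graph) : (0 < #|edge G|)%N -> (2 <= chromatic_number G)%N.
Proof.
move=> /card_gt0P [e _]; rewrite /chromatic_number.
case: ex_minnP => c /colorable_edge [f col_f] _.
have [u [v he]] := ends_pair e; have := col_f _ _ _ he.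
have := ltn_ord (f u); have := ltn_ord (f v); rewrite -val_eqE /=; lia.
Qed.

(** This is what evaluates the ratio of the balanced cover: it says
    ['C(2h, h) / (2 * 'C(2h - 2, h - 1)) = (2h - 1) / h] for [h = m + 1]. *)
Lemma central_bin_step (m : nat) :
  ('C(m.+1.*2, m.+1) * m.+1 = (m.*2.+1 * 2) * 'C(m.*2, m))%N.
Proof.
have h1 := mul_bin_diag m.*2.+2 m.
have h2 := mul_bin_diag m.*2.+1 m.
have h3 : 'C(m.*2.+1, m) = 'C(m.*2.+1, m.+1).
  by rewrite -bin_sub; [congr ('C(_, _)); lia | lia].
rewrite !doubleS /= in h1 h2 *; nia.
Qed.

Local Open Scope ring_scope.

Lemma ceil_half (R : realType) (c : nat) :
  Num.ceil (c%:R / 2 : R) = (uphalf c)%:Z.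
Proof.
apply: ceil_def; rewrite intrB -pmulrn.
have -> : c%:R = (uphalf c)%:R * 2 - (odd c)%:R :> R.
  apply/eqP; rewrite eq_sym subr_eq -natrM -natrD eqr_nat uphalf_half; apply/eqP.
  by have := odd_double_half c; case: (odd c) => /=; lia.
by apply/andP; split; case: (odd c); rewrite /=; lra.
Qed.

(** * Bounds on the cut-covering number *)

Section CutCoverNumber.

Context {R : realType} {G : graph}.

Lemma cut_cover_number_le {n k : nat} {X : n.-tuple {set edge G}} :
  (0 < n)%N -> (0 < k)%N -> is_cover k X ->
  cut_cover_number R G <= n%:R / k%:R.
Proof.
move=> n_gt0 k_gt0 covX; apply: ge_inf.
  by exists 0 => _ [n' [k' [_ _ _ ->]]]; apply: divr_ge0; apply: ler0n.
by exists n, k; split=> //; exists X.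
Qed.

Context (edgeG : (0 < #|edge G|)%N).

Let h := uphalf (chromatic_number G).

Lemma half_chromatic_gt0 : (0 < h)%N.
Proof. by have := chromatic_number_ge2 G edgeG; rewrite /h; lia. Qed.

(** The chromatic number may be odd; one spare colour then makes the number of
    colours even, which is why the bound involves its half rounded up. *)
Lemma balanced_cover : exists n k (X : n.-tuple {set edge G}),
  [/\ (0 < n)%N, (0 < k)%N, is_cover k X & n%:R / k%:R = 2 - h%:R^-1 :> R].
Proof.
have := half_chromatic_gt0; case E: h => [//|m] _.
have : colorable G m.+1.*2.
  apply: (@colorableW _ (chromatic_number G)); first by rewrite -E /h; lia.
  by rewrite /chromatic_number; case: ex_minnP.
case/colorable_cover => X covX.
have C_gt0 : (0 < 'C(m.*2, m))%N by rewrite bin_gt0; lia.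
exists 'C(m.+1.*2, m.+1), (2 * 'C(m.*2, m))%N, X; split=> //.
- by rewrite bin_gt0; lia.
- by rewrite muln_gt0.
have /eqP := central_bin_step m.
rewrite -(eqr_nat R) !natrM -!natr1 -[m.*2]muln2 natrM => /eqP hC.
have m_neq0 : m%:R + 1 != 0 :> R by rewrite natr1 pnatr_eq0.
have C_neq0 : 'C(m * 2, m)%:R != 0 :> R by rewrite pnatr_eq0 muln2 -lt0n.
apply: (mulIf m_neq0); rewrite mulrAC hC; field.
by rewrite C_neq0 m_neq0.
Qed.

Lemma cut_cover_number_le_chromatic : cut_cover_number R G <= 2 - h%:R^-1.
Proof.
by have [n [k [X [n0 k0 covX <-]]]] := balanced_cover; apply: cut_cover_number_le covX.
Qed.

(** The infimum of the empty set of reals is [0], so a lower bound on all ratios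
    only passes to the infimum because some cover exists. *)
Lemma le_cut_cover_number (r : R) :
  (forall n k (X : n.-tuple {set edge G}), (0 < k)%N -> is_cover k X -> r * k%:R <= n%:R) ->
  r <= cut_cover_number R G.
Proof.
move=> le_r; apply: lb_le_inf.
  have [n [k [X [n0 k0 covX _]]]] := balanced_cover.
  by exists (n%:R / k%:R); exists n, k; split=> //; exists X.
move=> _ [n [k [_ k0 [X covX] ->]]].
by rewrite ler_pdivlMr ?ltr0n //; apply: le_r covX.
Qed.

Lemma odd_girth_le_cut_cover_number :
  1 + odd_girth_frac G 1 1 <= cut_cover_number R G.
Proof.
apply: le_cut_cover_number => n k X k0 covX; rewrite /odd_girth_frac /odd_girth.
case: pselect => [ex_g|_]; last first.
  by rewrite addr0 mul1r ler_nat (cover_leq edgeG covX).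
case: ex_minnP => g /andP [odd_g cyc_g] _.
have g_gt2 := odd_cycle_gt2 odd_g cyc_g.
have := cover_odd_cycle g covX odd_g cyc_g.
rewrite -(ler_nat R) !natrM -subn1 natrB ?(ltnW (ltnW g_gt2)) //.
have : (2 : R) < g%:R by rewrite ltr_nat.
move=> g2 le_gk; rewrite -(ler_pM2r (_ : 0 < g%:R - 1)); last by lra.
rewrite (_ : _ * _ = g%:R * k%:R) //; field; lra.
Qed.

End CutCoverNumber.

(** * The cubical chromatic number *)

(** The map [x |-> 2 / (2 - x)] sends the odd girth bound on [x] to the one on
    [chi_q]: with [x = g / (g - 1)] it gives [2 (g - 1) / (g - 2)]. *)
Lemma odd_girth_frac_transfer (R : realType) (G : graph) :
  2 / (2 - (1 + odd_girth_frac G 1 1)) = 2 + odd_girth_frac G 2 2 :> R.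
Proof.
rewrite /odd_girth_frac /odd_girth; case: pselect => [ex_g|_]; last by field.
case: ex_minnP => g /andP [odd_g cyc_g] _.
have g2 : (2 : R) < g%:R by rewrite ltr_nat (odd_cycle_gt2 odd_g cyc_g).
by field; lra.
Qed.

Lemma odd_girth_frac_ge0 (R : realType) (G : graph) :
  0 <= odd_girth_frac G 1 1 :> R.
Proof.
rewrite /odd_girth_frac /odd_girth; case: pselect => // ex_g.
case: ex_minnP => g /andP [odd_g cyc_g] _.
have g2 : (2 : R) < g%:R by rewrite ltr_nat (odd_cycle_gt2 odd_g cyc_g).
by apply: divr_ge0; lra.
Qed.

Theorem corollary2p3 (R : realType) (G : graph) (hE : (0 < #|edge G|)%N) :
  let x : R := cut_cover_number R G in
  let chi_q : R := cubical_chromatic_number R G in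
  let half_chi : R := (Num.ceil ((chromatic_number G)%:R / 2 : R))%:~R in
  (2 + odd_girth_frac G 2 2 <= chi_q /\ chi_q <= 2 * half_chi) /\
  (1 + odd_girth_frac G 1 1 <= x /\ x <= 2 - half_chi^-1) /\
  (1 <= x /\ x < 2) /\
  2 <= chi_q.
Proof.
move=> x chi_q half_chi.
have -> : half_chi = (uphalf (chromatic_number G))%:R by rewrite /half_chi ceil_half.
set h : R := (uphalf _)%:R.
have h_gt0 : 0 < h by rewrite ltr0n half_chromatic_gt0.
have x_le : x <= 2 - h^-1 := cut_cover_number_le_chromatic hE.
have le_x : 1 + odd_girth_frac G 1 1 <= x := odd_girth_le_cut_cover_number hE.
have hV_gt0 : 0 < h^-1 by rewrite invr_gt0.
have x_ge1 : 1 <= x by have := odd_girth_frac_ge0 R G; lra.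
have chi_q_mono y : y <= x -> 2 / (2 - y) <= chi_q.
  move=> le_yx; rewrite ler_pM2l // lef_pV2 ?posrE; lra.
split; [split | split; [by []|split; [split=> //; lra|]]].
- by rewrite -odd_girth_frac_transfer; apply: chi_q_mono.
- by rewrite ler_pM2l // -[leRHS]invrK lef_pV2 ?posrE; lra.
- by have := chi_q_mono _ x_ge1; rewrite (_ : 2 - 1 = 1) ?divr1 //; lra.
Qed.
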